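(* A perfect cuboid exists if and only if there exist rational numbers $\alpha_3,\beta_3,\gamma_3\in\mathbb{Q}\setminus\{0,1,-1\}$ satisfying $$\Big(\frac{1-\gamma_3^2}{2\gamma_3}\Big)^2+\Big(\frac{1-\beta_3^2}{2\beta_3}\Big)^2=\Big(\frac{1-\alpha_3^2}{2\alpha_3}\Big)^2.$$
   Context: A perfect cuboid is a triple of positive rational numbers $a,b,c$ such that $a^2+b^2$, $b^2+c^2$, $a^2+c^2$ and $a^2+b^2+c^2$ are all squares of rational numbers. *)

(* Defs.v *)
From HB Require Import structures.
From mathcomp Require Import all_boot all_order all_algebra.
Set Implicit Arguments.
Unset Strict Implicit.
Unset Printing Implicit Defensive.
Import Order.TTheory GRing.Theory Num.Theory.
Local Open Scope ring_scope.

Definition is_rat_square (x : rat) : Prop := exists r : rat, x = r ^+ 2.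

Definition perfect_cuboid (a b c : rat) : Prop :=
  (0 < a /\ 0 < b /\ 0 < c) /\
  is_rat_square (a ^+ 2 + b ^+ 2) /\
  is_rat_square (b ^+ 2 + c ^+ 2) /\
  is_rat_square (a ^+ 2 + c ^+ 2) /\
  is_rat_square (a ^+ 2 + b ^+ 2 + c ^+ 2).

(* Main.v *)
(** The map t |-> (1 - t^2) / (2 t) parametrizes the nonzero x for which
    x^2 + 1 is a square: (s - x)(s + x) = 1 whenever s^2 = x^2 + 1, and
    t = s - x is a parameter of x.  Scaling a cuboid so that its third edge
    is 1, the other edges and the diagonal of their face are three such x. *)
Require Import Defs.
From HB Require Import structures.
From mathcomp Require Import all_boot all_order all_algebra ring.
Set Implicit Arguments.
Unset Strict Implicit.
Unset Printing Implicit Defensive.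
Import Order.TTheory GRing.Theory Num.Theory.
Local Open Scope ring_scope.

(** Half the difference of [t^-1] and [t]; for [t] the tangent of a half angle, the cotangent of the
    angle. *)
Definition half_diff (F : fieldType) (t : F) : F := (1 - t ^+ 2) / (2%:R * t).

Lemma half_diff_sqrD1 (F : numFieldType) (t : F) : t != 0 ->
  half_diff t ^+ 2 + 1 = ((1 + t ^+ 2) / (2%:R * t)) ^+ 2.
Proof. by move=> t0; rewrite /half_diff; field. Qed.

Lemma half_diff_neq0 (F : numFieldType) (t : F) :
  t != 0 -> t != 1 -> t != -1 -> half_diff t != 0.
Proof.
move=> t0 t1 tN1; rewrite /half_diff mulf_neq0 ?invr_eq0 ?mulf_neq0 ?pnatr_eq0 //.
by rewrite subr_eq0 eq_sym sqrf_eq1 negb_or t1.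
Qed.

Lemma half_diff_surj (F : numFieldType) (x s : F) :
  x != 0 -> x ^+ 2 + 1 = s ^+ 2 ->
  exists t, (t != 0 /\ t != 1 /\ t != -1) /\ half_diff t = x.
Proof.
move=> x0 xs; have inv : (s - x) * (s + x) = 1 by rewrite -subr_sqr -xs; ring.
have t0 : s - x != 0.
  by apply: contra_eq_neq inv => ->; rewrite mul0r eq_sym oner_neq0.
have tx : half_diff (s - x) = x.
  (* Writing the 1 of the numerator as [(s - x) * (s + x)] makes the numerator
     [(s - x) * (2 * x)]. *)
  rewrite /half_diff -[X in X - _]inv.
  by field.
exists (s - x); split=> //; split=> //; split; apply: contra_neq x0 => t1.
  by rewrite -tx t1 /half_diff expr1n subrr mul0r.
by rewrite -tx t1 /half_diff sqrrN expr1n subrr mul0r.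
Qed.

Theorem theorem3 :
  (exists a b c : rat, perfect_cuboid a b c) <->
  (exists alpha3 beta3 gamma3 : rat,
    (alpha3 != 0 /\ alpha3 != 1 /\ alpha3 != -1) /\
    (beta3 != 0 /\ beta3 != 1 /\ beta3 != -1) /\
    (gamma3 != 0 /\ gamma3 != 1 /\ gamma3 != -1) /\
    ((1 - gamma3 ^+ 2) / (2%:R * gamma3)) ^+ 2
      + ((1 - beta3 ^+ 2) / (2%:R * beta3)) ^+ 2
    = ((1 - alpha3 ^+ 2) / (2%:R * alpha3)) ^+ 2).
Proof.
split=> [[a [b [c [[a0 [b0 c0]] [[w wE] [[v vE] [[u uE] [d dE]]]]]]]]|].
  have nc : c != 0 by rewrite gt_eqF.
  have scaleD1 (x y : rat) : x ^+ 2 + c ^+ 2 = y ^+ 2 ->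
      (x / c) ^+ 2 + 1 = (y / c) ^+ 2.
    by move=> xy; rewrite [RHS]expr_div_n -xy; field.
  have nw : w != 0.
    by rewrite -sqrf_eq0 -wE gt_eqF // addr_gt0 ?exprn_gt0.
  have nz x : x != 0 -> x / c != 0 by move=> x0; rewrite mulf_neq0 ?invr_eq0.
  have [g [hg gE]] := half_diff_surj (nz _ (lt0r_neq0 a0)) (scaleD1 _ _ uE).
  have [be [hb bE]] := half_diff_surj (nz _ (lt0r_neq0 b0)) (scaleD1 _ _ vE).
  (* The face diagonal [w] and the edge [c] are legs of a right triangle whose hypotenuse is the
     space diagonal [d]. *)
  have wd : w ^+ 2 + c ^+ 2 = d ^+ 2 by rewrite -wE.
  have [al [ha aE]] := half_diff_surj (nz _ nw) (scaleD1 _ _ wd).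
  exists al, be, g; do 3!split=> //.
  rewrite -!/(half_diff _) aE bE gE.
  by rewrite [RHS]expr_div_n -wE; field.
move=> [al [be [g [[a0 _] [[b0 [b1 bN1]] [[g0 [g1 gN1]]]]]]]].
rewrite -!/(half_diff _) => sumE.
(* [half_diff] may be negative, while edges are positive; absolute values leave the squares
   unchanged. *)
exists `|half_diff g|, `|half_diff be|, 1.
rewrite /perfect_cuboid !normr_gt0 !half_diff_neq0 //.
(* By [sumE] the first face diagonal squared is [half_diff al ^+ 2]; the other three sums have the
   form [half_diff t ^+ 2 + 1]. *)
rewrite !real_normK ?num_real // expr1n sumE !half_diff_sqrD1 //.
by split=> //; do !split; eexists; reflexivity.
Qed.
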